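(* There is an arithmetic term $T_4$ in one variable such that for all natural numbers $n \geq 2$, the value $T_4(n)$ is the greatest prime less than or equal to $n$.
   Context: $\mathbb{N}$ includes $0$. Arithmetic terms are the expressions, interpreted as functions on $\mathbb{N}$, defined inductively: the constants $0$, $1$ and the variables are arithmetic terms; if $t_1, t_2$ are arithmetic terms, then so are $(t_1 + t_2)$, $(t_1 \mathbin{\dot{-}} t_2)$, $(t_1 * t_2)$, $(t_1 / t_2)$ and $2^{t_1}$. Here $a \mathbin{\dot{-}} b = \max(a-b, 0)$ and $a/b = \lfloor a/b \rfloor$ is the quotient of integer division, with $a/0 := 0$. *)

(* Defs.v *)
From mathcomp Require Import all_boot.

Set Implicit Arguments.
Unset Strict Implicit.
Unset Printing Implicit Defensive.

(* Arithmetic terms whose variables are among k variables x_0, ..., x_(k-1). *)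
Inductive aterm (k : nat) : Type :=
  | AZero
  | AOne
  | AVar of 'I_k
  | AAdd of aterm k & aterm k
  | ASub of aterm k & aterm k
  | AMul of aterm k & aterm k
  | ADiv of aterm k & aterm k
  | AExp2 of aterm k.

(* On nat, subtraction is truncated at 0 and m %/ 0 = 0 (divn0). *)
Fixpoint aeval (k : nat) (x : 'I_k -> nat) (t : aterm k) : nat :=
  match t with
  | AZero => 0
  | AOne => 1
  | AVar i => x i
  | AAdd t1 t2 => aeval x t1 + aeval x t2
  | ASub t1 t2 => aeval x t1 - aeval x t2
  | AMul t1 t2 => aeval x t1 * aeval x t2
  | ADiv t1 t2 => aeval x t1 %/ aeval x t2
  | AExp2 t1 => 2 ^ aeval x t1
  end.

Definition aeval1 (t : aterm 1) (n : nat) : nat := aeval (fun=> n) t.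

Definition greatest_prime_le (n p : nat) : Prop :=
  [/\ prime p, p <= n & forall q, prime q -> q <= n -> q <= p].

(* Main.v *)
Require Import Defs.
From mathcomp Require Import all_boot.
From mathcomp Require Import zify.

(* The greatest prime at most n is the number of j < n such that some prime lies
   in (j, n], and primality itself can be read off the number of divisors, so it
   is enough that functions given by arithmetic terms are closed under counting
   the zeros i < N of f(i).

   Flattening the term for f, with auxiliary unknowns for the values of the
   subterms, turns f(i) = 0 into one equation P = Q, where Q <= P are sums of
   monomials in i, the unknowns and powers of 2 of these, and where the unknowns
   are determined by i and bounded by an arithmetic term. The values of a monomial
   on a box, written as the blocks of one large binary number, sum up to a product
   of sums of the form sum_v v^d q^v, which are arithmetic terms. Multiplying the
   number with blocks P - Q < 2^u by 2^u - 1 leaves exactly u ones in each nonzero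
   block, so the number of solutions follows from the number of ones, and the
   number of ones of a is the exponent of 2 in the binomial coefficient C(2a, a). *)

Set Implicit Arguments.
Unset Strict Implicit.
Unset Printing Implicit Defensive.

(** * Closure properties of arithmetic terms *)

(** Assignments are lists padded with zeros, so that binding a new variable 0 is consing its
    value. *)
Definition env k (s : seq nat) (i : 'I_k) : nat := nth 0 s i.

Definition arith k (f : seq nat -> nat) : Prop :=
  exists t : aterm k, forall s, aeval (env s) t = f s.

Section ArithClosure.
Variable k : nat.
Implicit Types f g : seq nat -> nat.

Lemma arith_ext f g : f =1 g -> arith k f -> arith k g.
Proof. by move=> fg [t tf]; exists t => s; rewrite tf fg. Qed.

Lemma arith_var i : i < k -> arith k (fun s => nth 0 s i).
Proof. by move=> ik; exists (AVar (Ordinal ik)). Qed.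

Lemma arith_const n : arith k (fun=> n).
Proof.
elim: n => [|n [t tn]]; first by exists (AZero k).
by exists (AAdd t (AOne k)) => s; rewrite /= tn addn1.
Qed.

Lemma arith_add f g : arith k f -> arith k g -> arith k (fun s => f s + g s).
Proof. by move=> [t tf] [u ug]; exists (AAdd t u) => s; rewrite /= tf ug. Qed.

Lemma arith_sub f g : arith k f -> arith k g -> arith k (fun s => f s - g s).
Proof. by move=> [t tf] [u ug]; exists (ASub t u) => s; rewrite /= tf ug. Qed.

Lemma arith_mul f g : arith k f -> arith k g -> arith k (fun s => f s * g s).
Proof. by move=> [t tf] [u ug]; exists (AMul t u) => s; rewrite /= tf ug. Qed.

Lemma arith_div f g : arith k f -> arith k g -> arith k (fun s => f s %/ g s).
Proof. by move=> [t tf] [u ug]; exists (ADiv t u) => s; rewrite /= tf ug. Qed.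

Lemma arith_exp2 f : arith k f -> arith k (fun s => 2 ^ f s).
Proof. by move=> [t tf]; exists (AExp2 t) => s; rewrite /= tf. Qed.

Lemma arith_mod f g : arith k f -> arith k g -> arith k (fun s => f s %% g s).
Proof.
move=> af ag; apply: (@arith_ext (fun s => f s - f s %/ g s * g s)).
  by move=> s; rewrite {1}(divn_eq (f s) (g s)) addKn.
by apply: arith_sub => //; apply: arith_mul => //; apply: arith_div.
Qed.

Lemma arith_sum (I : Type) (l : seq I) (F : I -> seq nat -> nat) :
  (forall i, arith k (F i)) -> arith k (fun s => \sum_(i <- l) F i s).
Proof.
move=> aF; elim: l => [|i l IHl].
  by apply: (@arith_ext (fun=> 0)) (arith_const 0) => s; rewrite big_nil.
by apply: arith_ext (arith_add (aF i) IHl) => s; rewrite big_cons.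
Qed.

Lemma arith_prod (I : Type) (l : seq I) (F : I -> seq nat -> nat) :
  (forall i, arith k (F i)) -> arith k (fun s => \prod_(i <- l) F i s).
Proof.
move=> aF; elim: l => [|i l IHl].
  by apply: (@arith_ext (fun=> 1)) (arith_const 1) => s; rewrite big_nil.
by apply: arith_ext (arith_mul (aF i) IHl) => s; rewrite big_cons.
Qed.

End ArithClosure.

(** * Powers with arbitrary base *)

Lemma leq_expl m n e : m <= n -> m ^ e <= n ^ e.
Proof. by case: e => // e mn; rewrite leq_exp2r. Qed.

(* [2 ^ c] is congruent to [a] modulo [2 ^ c - a]. *)
Lemma expn_modn_exp2 a b (c := a * b + a + 1) :
  2 ^ (c * b) %% (2 ^ c - a) = a ^ b.
Proof.
have a2 : a < 2 ^ a by exact: ltn_expl.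
have le_ac : a <= 2 ^ c.
  apply: leq_trans (ltnW a2) _; rewrite leq_exp2l // /c; lia.
have ab2 : a ^ b <= 2 ^ (a * b) by rewrite expnM; exact/leq_expl/ltnW.
rewrite expnM -modnXm.
have -> : 2 ^ c %% (2 ^ c - a) = a %% (2 ^ c - a).
  by rewrite -{1}(subnK le_ac) modnDl.
(* The choice of [c] gives [2 ^ c = 2 * 2 ^ (a * b) * 2 ^ a], which exceeds [a ^ b + a]. *)
rewrite modnXm modn_small // /c addn1 expnS expnD.
have := expn_gt0 2 (a * b); have := expn_gt0 2 a => /=; nia.
Qed.

Lemma arith_exp k f g : arith k f -> arith k g -> arith k (fun s => f s ^ g s).
Proof.
move=> af ag; apply: arith_ext (fun s => expn_modn_exp2 (f s) (g s)) _.
have ac : arith k (fun s => f s * g s + f s + 1).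
  by do !apply: arith_add; rewrite //; [exact: arith_mul|exact: arith_const].
apply: arith_mod; first by apply: arith_exp2; apply: arith_mul.
by apply: arith_sub => //; apply: arith_exp2.
Qed.

(** * Greatest common divisors and the 2-adic valuation *)

Lemma sum_dvdn_mul c g : 0 < c -> \sum_(i < c * g) (c %| i : nat) = g.
Proof.
move=> c0; elim: g => [|g IHg]; first by rewrite muln0 big_ord0.
rewrite mulnS addnC big_split_ord /= IHg -[RHS]addn1; congr (_ + _).
rewrite (bigD1 (Ordinal c0)) //= addn0 dvdn_mulr // big1 // => i i0.
rewrite dvdn_addr ?dvdn_mulr // gtnNdvd // lt0n.
by apply: contraNneq i0 => i0; apply/eqP/val_inj.
Qed.

(** After division by the gcd [g], [d] and [m] become coprime numbers [c] and [e], so [d] divides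
    [i * m] exactly when [c] divides [i]. *)
Lemma sum_dvdn_gcd m d : 0 < d -> \sum_(i < d) (d %| i * m : nat) = gcdn m d.
Proof.
move=> d0; have g0 : 0 < gcdn m d by rewrite gcdn_gt0 d0 orbT.
have /dvdnP[c dE] := dvdn_gcdr m d; have /dvdnP[e mE] := dvdn_gcdl m d.
set g := gcdn m d in g0 dE mE *.
have c0 : 0 < c by move: d0; rewrite dE muln_gt0 => /andP[].
have ce : coprime c e.
  rewrite /coprime -(eqn_pmul2r g0) mul1n muln_gcdl -dE -mE gcdnC; exact: eqxx.
rewrite -[RHS](sum_dvdn_mul g c0) -dE; apply: eq_bigr => i _; congr (nat_of_bool _).
by rewrite mE {1}dE mulnA dvdn_pmul2r // Gauss_dvdl.
Qed.

(* Modulo [2 ^ (d * d) - 1] the geometric sum becomes the sum of the powers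
   [2 ^ (d * (i * m %% d))], whose constant term in base [2 ^ d] counts the
   [i < d] such that [d] divides [i * m]. *)
Lemma gcdn_geometric m d : 0 < m -> 1 < d ->
  (2 ^ (d * m * d)).-1 %/ (2 ^ (d * m)).-1 %% (2 ^ (d * d)).-1 %% 2 ^ d
    = gcdn m d.
Proof.
move=> m0 d1; have d0 : 0 < d by exact: ltnW.
have xd : d < 2 ^ d by exact: ltn_expl.
have big1m j : 0 < j -> 1 < 2 ^ (d * j).
  by move=> j0; rewrite -{1}(expn0 2) ltn_exp2l // muln_gt0 d0.
rewrite expnM predn_exp mulKn; last by rewrite -ltnS prednK ?expn_gt0 // big1m.
set N := (2 ^ (d * d)).-1.
have xN : 2 ^ (d * d) = 1 %[mod N].
  by rewrite -[2 ^ (d * d)]prednK ?expn_gt0 // -/N -addn1 modnDl.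
have -> : \sum_(i < d) (2 ^ (d * m)) ^ i = \sum_(i < d) 2 ^ (d * (i * m %% d)) %[mod N].
  rewrite -modn_summ -[RHS]modn_summ; congr (_ %% _); apply: eq_bigr => i _.
  have -> : (2 ^ (d * m)) ^ i = (2 ^ (d * d)) ^ (i * m %/ d) * 2 ^ (d * (i * m %% d)).
    rewrite -!expnM -expnD -!mulnA -mulnDr [m * i]mulnC.
    by rewrite [d * (_ %/ _)]mulnC -divn_eq.
  by rewrite -modnMml -modnXm xN modnXm exp1n modnMml mul1n.
(* The [d] summands are at most [2 ^ (d * d.-1)] and [d < 2 ^ d], so the sum is its own residue
   modulo [N]. *)
rewrite (@modn_small _ N); last first.
  apply: (@leq_ltn_trans (d * 2 ^ (d * d.-1))).
    rewrite -[X in X * _]card_ord -sum_nat_const leq_sum // => i _.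
    by rewrite leq_exp2l // leq_mul2l -ltnS prednK // ltn_mod d0 orbT.
  have d2 : 1 < 2 ^ (d * d.-1) by rewrite big1m // -ltnS prednK.
  rewrite /N; have -> : d * d = d + d * d.-1 by rewrite -mulnS prednK.
  rewrite expnD; nia.
rewrite -modn_summ.
have -> : \sum_(i < d) 2 ^ (d * (i * m %% d)) %% 2 ^ d = gcdn m d.
  rewrite -sum_dvdn_gcd //; apply: eq_bigr => i _; rewrite /dvdn.
  case: eqVneq => [->|]; first by rewrite muln0 modn_small // (ltn_trans _ xd).
  by rewrite -lt0n => /prednK <-; rewrite mulnS expnD modnMr.
rewrite modn_small // (leq_ltn_trans _ xd) //.
by rewrite dvdn_leq // dvdn_gcdr.
Qed.

(** Since [logn 2 m <= m], the whole 2-part of [m] divides [2 ^ m], and the cofactor of [m] is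
    odd. *)
Lemma gcdn_exp2_log m : 0 < m -> gcdn m (2 ^ m) = 2 ^ logn 2 m.
Proof.
move=> m0; have [e e2 mE] := pfactor_coprime (isT : prime 2) m0.
have vm : logn 2 m <= m by exact/ltnW/ltn_logl.
move: (logn 2 m) vm mE => v vm mE.
rewrite -[in 2 ^ m](subnKC vm) {1}mE expnD mulnC -muln_gcdr -[RHS]muln1.
by congr (_ * _); apply/eqP; rewrite -/(coprime _ _) coprimeXr // coprime_sym.
Qed.

(* [2 ^ m.+1] is [1 + N], hence its powers are linear in the exponent modulo
   [N ^ 2]. *)
Lemma logn2_modn m (N := (2 ^ m.+1).-1) : 0 < m ->
  gcdn m (2 ^ m) ^ m.+1 %% N ^ 2 %/ N = logn 2 m.
Proof.
move=> m0; rewrite gcdn_exp2_log //; have := ltn_logl 2 m0.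
move: (logn 2 m) => v vm; have m2 : m < 2 ^ m by exact: ltn_expl.
have NE : 2 ^ m.+1 = N.+1 by rewrite prednK // expn_gt0.
have vN : v.+1 < N by rewrite expnS in NE; lia.
have powN e : N.+1 ^ e = 1 + e * N %[mod N ^ 2].
  elim: e => [|e IHe]; first by rewrite mul0n.
  rewrite expnS -modnMmr IHe modnMmr.
  have -> : N.+1 * (1 + e * N) = e * N ^ 2 + (1 + e.+1 * N) by nia.
  by rewrite modnMDl.
(* Exchanging the exponents turns the power into [N.+1 ^ v], that is [1 + v * N] modulo [N ^ 2], and
   this is already reduced. *)
rewrite -expnM mulnC expnM NE powN modn_small; last by nia.
by rewrite addnC divnMDl ?divn_small ?addn0 //; lia.
Qed.

Lemma arith_logn2 k f : (forall s, 0 < f s) -> arith k f ->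
  arith k (fun s => logn 2 (f s)).
Proof.
move=> f0 af; have ac n := arith_const k n.
apply: (@arith_ext _ (fun s => gcdn (f s) (2 ^ f s) ^ (f s + 1)
    %% (2 ^ (f s + 1) - 1) ^ 2 %/ (2 ^ (f s + 1) - 1))).
  by move=> s; rewrite addn1 subn1 logn2_modn.
have aN : arith k (fun s => 2 ^ (f s + 1) - 1).
  by apply: arith_sub => //; apply: arith_exp2; apply: arith_add.
apply: arith_div => //; apply: arith_mod; last by apply: arith_exp.
apply: arith_exp; last by apply: arith_add.
pose d s := 2 ^ f s; have ad : arith k d by apply: arith_exp2.
apply: (@arith_ext _ (fun s => (2 ^ (d s * f s * d s) - 1) %/
    (2 ^ (d s * f s) - 1) %% (2 ^ (d s * d s) - 1) %% 2 ^ d s)).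
  move=> s; rewrite !subn1 gcdn_geometric // -{1}(expn0 2).
  by rewrite ltn_exp2l.
have am g h : arith k g -> arith k h -> arith k (fun s => 2 ^ (g s * h s) - 1).
  by move=> ag ah; apply: arith_sub => //; apply: arith_exp2; apply: arith_mul.
apply: arith_mod; last by apply: arith_exp2.
apply: arith_mod; last by apply: am.
by apply: arith_div; apply: am => //; apply: arith_mul.
Qed.

(** * Central binomial coefficients and binary ones *)

Lemma bin_leq_exp2 n i : i <= n -> 'C(n, i) <= 2 ^ n.
Proof.
move=> i_n; rewrite -[2]/(1 + 1) expnDn.
rewrite (bigD1 (Ordinal (i_n : i < n.+1))) //= !exp1n !muln1; exact: leq_addr.
Qed.

Lemma digit_sum Q n (c : nat -> nat) j : (forall i, c i < Q) -> j < n ->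
  (\sum_(i < n) c i * Q ^ i) %/ Q ^ j %% Q = c j.
Proof.
elim: j n c => [|j IHj] [|n] c cQ // jn; rewrite big_ord_recl /= muln1.
  under eq_bigr => i _ do rewrite /bump /= add1n expnS mulnCA.
  by rewrite divn1 -big_distrr /= addnC mulnC modnMDl modn_small.
have Q0 : 0 < Q by exact: leq_ltn_trans (cQ 0).
under eq_bigr => i _ do rewrite /bump /= add1n expnS mulnCA.
rewrite -big_distrr /= expnS divnMA addnC [Q * _]mulnC divnMDl //.
rewrite [c 0 %/ Q]divn_small // addn0.
exact: (IHj n (fun i => c i.+1)).
Qed.

(** The binomial theorem makes the coefficients digits in base [2 ^ w]; they fit because each is at
    most [2 ^ a.*2]. *)
Lemma bin_central_modn a (w := a.*2.+1) :
  (1 + 2 ^ w) ^ a.*2 %/ 2 ^ (w * a) %% 2 ^ w = 'C(a.*2, a).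
Proof.
rewrite expnDn expnM.
under eq_bigr => i _ do rewrite exp1n mul1n.
apply: digit_sum => [i|]; last by rewrite ltnS -addnn leq_addr.
rewrite /w expnS.
have := expn_gt0 2 a.*2; have [/bin_leq_exp2|/bin_small] := leqP i a.*2 => /=; lia.
Qed.

(* The number of ones in the binary expansion of [a], by Kummer's theorem. *)
Definition popcount a := logn 2 'C(a.*2, a).

Lemma arith_popcount k f : arith k f -> arith k (fun s => popcount (f s)).
Proof.
move=> af; have ac n := arith_const k n.
apply: arith_logn2 => [s|]; first by rewrite bin_gt0 -addnn leq_addr.
apply: arith_ext (fun s => bin_central_modn (f s)) _.
have a2f : arith k (fun s => (f s).*2).
  by apply: arith_ext (fun s => mul2n (f s)) _; apply: arith_mul.
have aw : arith k (fun s => (f s).*2.+1).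
  by apply: arith_ext (fun s => addn1 (f s).*2) _; apply: arith_add.
have aw2 : arith k (fun s => 2 ^ (f s).*2.+1) by apply: arith_exp2.
apply: arith_mod => //; apply: arith_div.
  by apply: arith_exp => //; apply: arith_add.
by apply: arith_exp2; apply: arith_mul.
Qed.

(** Passing from [a] to [a + 1] multiplies by the odd number [2a + 1] and by [2(a + 1)]. *)
Lemma logn2_fact_double a : logn 2 (a.*2)`! = a + logn 2 a`!.
Proof.
elim: a => // a IHa; rewrite doubleS !factS.
have odd2 : logn 2 a.*2.+1 = 0 by rewrite lognE dvdn2 /= odd_double.
rewrite !lognM ?fact_gt0 ?muln_gt0 ?fact_gt0 // IHa odd2 -doubleS -mul2n.
by rewrite lognM // logn_prime //=; lia.
Qed.

(** Legendre's formula for the prime 2, from the valuations in [C(2a, a) * a! * a! = (2a)!]. *)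
Lemma popcountE a : popcount a + logn 2 a`! = a.
Proof.
have := @bin_fact a.*2 a; rewrite -{1 3}addnn leq_addr addnK => /(_ isT).
move/(congr1 (logn 2)); rewrite !lognM ?muln_gt0 ?fact_gt0 ?bin_gt0 //; last first.
  by rewrite -addnn leq_addr.
rewrite logn2_fact_double -/(popcount a); lia.
Qed.

Lemma popcount0 : popcount 0 = 0. Proof. by rewrite /popcount bin0. Qed.

(** With [popcount0], this recursion identifies [popcount] with the binary digit sum. *)
Lemma popcount_bit (b : bool) a : popcount (b + a.*2) = b + popcount a.
Proof.
have := popcountE (b + a.*2); have := popcountE a; have := logn2_fact_double a.
case: b => /=; rewrite ?add0n ?add1n; last by lia.
have odd2 : logn 2 a.*2.+1 = 0 by rewrite lognE dvdn2 /= odd_double.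
by rewrite factS lognM ?fact_gt0 // odd2; lia.
Qed.

Lemma popcountD w a b : a < 2 ^ w ->
  popcount (a + 2 ^ w * b) = popcount a + popcount b.
Proof.
elim: w a => [|w IHw] a; first by rewrite ltnS leqn0 => /eqP->; rewrite mul1n popcount0.
rewrite -(odd_double_half a) expnS => aw; have {}aw : a./2 < 2 ^ w by lia.
rewrite -mulnA mul2n -addnA -doubleD !popcount_bit IHw //; exact: addnA.
Qed.

(** Subtracting from a string of [w] ones flips every bit. *)
Lemma popcountC w a : a < 2 ^ w -> popcount a + popcount ((2 ^ w).-1 - a) = w.
Proof.
elim: w a => [|w IHw] a; first by rewrite ltnS leqn0 => /eqP->; rewrite popcount0.
rewrite -(odd_double_half a) => aw.
have {}aw : a./2 < 2 ^ w by rewrite expnS in aw; lia.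
have -> : (2 ^ w.+1).-1 - (odd a + a./2.*2) = ~~ odd a + ((2 ^ w).-1 - a./2).*2.
  by rewrite expnS; case: (odd a) => /=; lia.
rewrite !popcount_bit -[in RHS](IHw _ aw); case: (odd a) => /=; lia.
Qed.

Lemma popcount_mul_pred u a : a < 2 ^ u -> popcount ((2 ^ u).-1 * a) = u * (a != 0).
Proof.
case: a => [|a] au; first by rewrite !muln0 popcount0.
(* The low block is the bitwise complement of the high block [a], so together they have [u] ones. *)
have -> : (2 ^ u).-1 * a.+1 = (2 ^ u).-1 - a + 2 ^ u * a.
  by have := expn_gt0 2 u => /=; nia.
rewrite popcountD; last by have := expn_gt0 2 u => /=; lia.
by rewrite addnC (popcountC (ltnW au)) muln1.
Qed.

(* Abel summation, with [(v + 1) ^ d - v ^ d] expanded by the binomial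
   theorem. *)
Lemma geometric_power_sum d q U : 0 < q ->
  q.-1 * (\sum_(v < U) v ^ d * q ^ v)
    + q * (\sum_(i < d) 'C(d, i) * \sum_(v < U) v ^ i * q ^ v) + (d == 0)
  = U ^ d * q ^ U.
Proof.
move=> q0; elim: U => [|U IHU].
  rewrite big_ord0 big1 ?muln0 => [|i _]; last by rewrite big_ord0 muln0.
  by rewrite muln1; case: d => // d; rewrite exp0n.
rewrite big_ord_recr /=.
under [X in _ + q * X + _]eq_bigr => i _ do rewrite big_ord_recr mulnDr /=.
rewrite [X in _ + q * X + _]big_split /=.
have -> : U.+1 ^ d = U ^ d + \sum_(i < d) 'C(d, i) * U ^ i.
  rewrite -add1n expnDn big_ord_recr /= binn subnn mul1n mul1n addnC.
  by congr (_ + _); apply: eq_bigr => i _; rewrite exp1n mul1n.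
under [X in _ + q * (_ + X) + _]eq_bigr => i _ do rewrite mulnA.
rewrite -big_distrl /= expnS.
move: IHU; set S := \sum_(v < U) _; set B := \sum_(i < d) _ * \sum_(v < U) _.
set D := \sum_(i < d) _; clearbody S B D; move: (q ^ U) (U ^ d) => Q V.
by case: q q0 => // q _ /=; nia.
Qed.

(** The length [U s] varies, so a closed form is needed: [geometric_power_sum] is solved for the sum
    with exponent [d], by an exact division, the sums with smaller exponents being terms by
    induction. *)
Lemma arith_geometric k Q U d : (forall s, 1 < Q s) -> arith k Q -> arith k U ->
  arith k (fun s => \sum_(v < U s) v ^ d * Q s ^ v).
Proof.
move=> Q1 aQ aU; have ac n := arith_const k n.
elim/ltn_ind: d => d IHd.
apply: (@arith_ext _ (fun s => (U s ^ d * Q s ^ U s - (d == 0) -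
  Q s * \sum_(i <- enum 'I_d) 'C(d, i) * \sum_(v < U s) v ^ i * Q s ^ v)
  %/ (Q s - 1))).
  move=> s; rewrite -geometric_power_sum; last exact/ltnW.
  rewrite addnK big_enum addnK subn1 mulKn //; have := Q1 s; lia.
apply: arith_div; last exact: arith_sub.
apply: arith_sub.
  by apply: arith_sub => //; apply: arith_mul; apply: arith_exp.
apply: arith_mul => //; apply: arith_sum => i; apply: arith_mul => //.
exact: IHd.
Qed.

(** * Packed values on a box *)

(* The values of [F] on the box with side lengths [r] written as digits in base
   [2 ^ w], in lexicographic order of the points; a dimension of size [n] is
   given room for [n + 1] blocks so that all the shifts are positive. *)
Definition radix (r : seq nat) := \prod_(n <- r) n.+1.

Fixpoint packed w (r : seq nat) (F : seq nat -> nat) : nat :=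
  if r is n :: r' then
    \sum_(j < n) 2 ^ (w * radix r' * j) * packed w r' (fun v => F (nat_of_ord j :: v))
  else F [::].

Fixpoint box_sum (r : seq nat) (F : seq nat -> nat) : nat :=
  if r is n :: r' then \sum_(j < n) box_sum r' (fun v => F (nat_of_ord j :: v))
  else F [::].

Definition in_box (r v : seq nat) := all2 ltn v r.

Lemma eq_box_sum r F G : (forall v, in_box r v -> F v = G v) ->
  box_sum r F = box_sum r G.
Proof.
elim: r F G => [|n r IHr] F G FG /=; first exact: FG.
by apply: eq_bigr => j _; apply: IHr => v rv; apply: FG; rewrite /in_box /= ltn_ord.
Qed.

Lemma box_sumD r F G : box_sum r (fun v => F v + G v) = box_sum r F + box_sum r G.
Proof.
elim: r F G => [|n r IHr] F G //=.
by rewrite -big_split; apply: eq_bigr => j _; rewrite IHr.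
Qed.

Lemma box_sumZ r c F : box_sum r (fun v => c * F v) = c * box_sum r F.
Proof.
elim: r F => [|n r IHr] F //=.
by rewrite big_distrr; apply: eq_bigr => j _; rewrite IHr.
Qed.

Lemma box_sum1 r : box_sum r (fun=> 1) = \prod_(n <- r) n.
Proof.
elim: r => [|n r IHr] /=; first by rewrite big_nil.
by rewrite IHr sum_nat_const card_ord big_cons.
Qed.

Lemma box_sum0 r : box_sum r (fun=> 0) = 0.
Proof. by elim: r => //= n r IHr; rewrite big1. Qed.

Lemma box_sum_pred1 r v0 : in_box r v0 -> box_sum r (fun v => v == v0) = 1.
Proof.
elim: r v0 => [|n r IHr] [|j0 v0] //= /andP[jn rv0].
rewrite (bigD1 (Ordinal jn)) //= big1 ?addn0 => [|j jj0].
  by rewrite -(IHr v0 rv0); apply: eq_box_sum => v _; rewrite eqseq_cons eqxx.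
rewrite -[RHS](box_sum0 r); apply: eq_box_sum => v _; rewrite eqseq_cons.
by case: eqP => // jE; case/eqP: jj0; apply: val_inj.
Qed.

Lemma eq_packed w r F G : (forall v, size v = size r -> F v = G v) ->
  packed w r F = packed w r G.
Proof.
elim: r F G => [|n r IHr] F G FG /=; first exact: FG.
apply: eq_bigr => j _; congr (_ * _); apply: IHr => v rv.
by apply: FG; rewrite /= rv.
Qed.

Lemma packedD w r F G :
  packed w r (fun v => F v + G v) = packed w r F + packed w r G.
Proof.
elim: r F G => [|n r IHr] F G //=.
by rewrite -big_split; apply: eq_bigr => j _; rewrite IHr mulnDr.
Qed.

Lemma packedZ w r c F : packed w r (fun v => c * F v) = c * packed w r F.
Proof.
elim: r F => [|n r IHr] F //=.
by rewrite big_distrr; apply: eq_bigr => j _; rewrite IHr mulnCA.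
Qed.

Lemma packed_sum (I : Type) (l : seq I) w r (F : I -> seq nat -> nat) :
  packed w r (fun v => \sum_(i <- l) F i v) = \sum_(i <- l) packed w r (F i).
Proof.
elim: l => [|i l IHl].
  rewrite big_nil (@eq_packed _ _ _ (fun=> 0 * 0)) ?packedZ // => v _.
  by rewrite big_nil.
rewrite big_cons -IHl -packedD; apply: eq_packed => v _; exact: big_cons.
Qed.

Lemma sum_blocks_lt W n (a : nat -> nat) : (forall j, j < n -> a j < 2 ^ W) ->
  \sum_(j < n) 2 ^ (W * j) * a j < 2 ^ (W * n).
Proof.
elim: n => [|n IHn] aW; first by rewrite big_ord0 expn_gt0.
have {}IHn := IHn (fun j jn => aW j (ltnW jn)).
rewrite big_ord_recr /= mulnS expnD; have := aW n (ltnSn n).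
move: (\sum_(j < n) _) IHn => S; move: (2 ^ (W * n)) (2 ^ W) (a n) => B C x; nia.
Qed.

Lemma popcount_sum_blocks W n (a : nat -> nat) :
  (forall j, j < n -> a j < 2 ^ W) ->
  popcount (\sum_(j < n) 2 ^ (W * j) * a j) = \sum_(j < n) popcount (a j).
Proof.
elim: n => [|n IHn] aW; first by rewrite !big_ord0 popcount0.
have {}aW' j (jn : j < n) := aW j (ltnW jn).
by rewrite !big_ord_recr /= popcountD ?IHn // sum_blocks_lt.
Qed.

Lemma packed_lt w r F : (forall v, in_box r v -> F v < 2 ^ w) ->
  packed w r F < 2 ^ (w * radix r).
Proof.
elim: r F => [|n r IHr] F Fw /=; first by rewrite /radix big_nil muln1 Fw.
pose a j := packed w r (fun v => F (j :: v)).
have lt_sum : \sum_(j < n) 2 ^ (w * radix r * j) * a j < 2 ^ (w * radix r * n).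
  apply: sum_blocks_lt => j jn; apply: IHr => v rv; apply: Fw.
  by rewrite /in_box /= jn.
apply: leq_trans lt_sum _; rewrite leq_exp2l // /radix big_cons -mulnA.
by rewrite leq_mul2l mulnC leq_mul2r leqnSn !orbT.
Qed.

Lemma popcount_packed w r F : (forall v, in_box r v -> F v < 2 ^ w) ->
  popcount (packed w r F) = box_sum r (fun v => popcount (F v)).
Proof.
elim: r F => [|n r IHr] F Fw //=.
pose a j := packed w r (fun v => F (j :: v)).
rewrite (@popcount_sum_blocks (w * radix r) n a) => [|j jn].
  apply: eq_bigr => j _; apply: IHr => v rv; apply: Fw.
  by rewrite /in_box /= ltn_ord.
by apply: packed_lt => v rv; apply: Fw; rewrite /in_box /= jn.
Qed.

(* [2 ^ u - 1] times a nonzero [u]-bit number has exactly [u] ones in binary. *)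
Lemma popcount_packed_neq0 u r F : (forall v, in_box r v -> F v < 2 ^ u) ->
  popcount ((2 ^ u).-1 * packed (u + u) r F) = u * box_sum r (fun v => F v != 0).
Proof.
(* Multiplication by [2 ^ u - 1] widens the entries to at most [2u] bits, whence the block width
   [u + u]. *)
move=> Fu; rewrite -packedZ popcount_packed => [|v rv]; last first.
  have := expn_gt0 2 u; have := Fu _ rv; rewrite expnD /=; nia.
by rewrite -box_sumZ; apply: eq_box_sum => v rv; rewrite popcount_mul_pred ?Fu.
Qed.

Lemma box_sum_eq0 u r F : 0 < u -> (forall v, in_box r v -> F v < 2 ^ u) ->
  box_sum r (fun v => F v == 0) =
    \prod_(n <- r) n - popcount ((2 ^ u).-1 * packed (u + u) r F) %/ u.
Proof.
move=> u0 Fu; rewrite popcount_packed_neq0 // mulKn // -box_sum1.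
rewrite (@eq_box_sum r (fun=> 1) (fun v => (F v == 0) + (F v != 0))).
  by rewrite box_sumD addnK.
by move=> v _; case: eqP.
Qed.

(** * Exponential polynomials *)

Section Monomials.
Variable k : nat.

(** A coefficient in the parameters, and for each unknown [v_i] the exponents [(d, e)] of its factor
    [v_i ^ d * 2 ^ (e * v_i)]. *)
Definition mono := (aterm k * (nat -> nat * nat))%type.

Definition power_prod (de : nat -> nat * nat) (v : seq nat) :=
  \prod_(i < size v) (nth 0 v i ^ (de i).1 * 2 ^ ((de i).2 * nth 0 v i)).

Definition meval (s v : seq nat) (x : mono) :=
  aeval (env s) x.1 * power_prod x.2 v.

(** The length of [v] is only bounded below, so that further unknowns can be appended. *)
Definition exp_poly m (F : seq nat -> seq nat -> nat) :=
  exists l : seq mono, forall s v, m <= size v -> F s v = \sum_(x <- l) meval s v x.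

Lemma exp_poly_widen m m' F : m <= m' -> exp_poly m F -> exp_poly m' F.
Proof. by move=> mm' [l lF]; exists l => s v /(leq_trans mm'); apply: lF. Qed.

Lemma exp_poly_param m c : arith k c -> exp_poly m (fun s _ => c s).
Proof.
move=> [t tc]; exists [:: (t, fun=> (0, 0))] => s v _.
by rewrite big_seq1 /meval /= tc /power_prod big1 ?muln1.
Qed.

Lemma power_prod_single d e i v : i < size v ->
  power_prod (fun j => if j == i then (d, e) else (0, 0)) v
    = nth 0 v i ^ d * 2 ^ (e * nth 0 v i).
Proof.
move=> iv; rewrite /power_prod (bigD1 (Ordinal iv)) //= eqxx big1 ?muln1 // => j ji.
by rewrite ifN.
Qed.

Lemma exp_poly_var m i : i < m -> exp_poly m (fun _ v => nth 0 v i).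
Proof.
move=> im; exists [:: (AOne k, fun j => if j == i then (1, 0) else (0, 0))] => s v mv.
rewrite big_seq1 /meval /= power_prod_single ?(leq_trans im) //.
by rewrite muln1 mul1n.
Qed.

Lemma exp_poly_exp2 m i : i < m -> exp_poly m (fun _ v => 2 ^ nth 0 v i).
Proof.
move=> im; exists [:: (AOne k, fun j => if j == i then (0, 1) else (0, 0))] => s v mv.
rewrite big_seq1 /meval /= power_prod_single ?(leq_trans im) //.
by rewrite !mul1n.
Qed.

Lemma exp_polyD m F G : exp_poly m F -> exp_poly m G ->
  exp_poly m (fun s v => F s v + G s v).
Proof.
move=> [l lF] [l' lG]; exists (l ++ l') => s v mv.
by rewrite big_cat lF ?lG.
Qed.

Lemma exp_polyM m F G : exp_poly m F -> exp_poly m G ->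
  exp_poly m (fun s v => F s v * G s v).
Proof.
move=> [l lF] [l' lG].
pose mul (x y : mono) : mono :=
  (AMul x.1 y.1, fun i => ((x.2 i).1 + (y.2 i).1, (x.2 i).2 + (y.2 i).2)).
exists (allpairs mul l l') => s v mv; rewrite big_allpairs_dep lF // lG //.
rewrite big_distrlr /=; apply: eq_bigr => x _; apply: eq_bigr => y _.
rewrite /meval /= mulnACA -big_split /=; congr (_ * _); apply: eq_bigr => i _.
by rewrite expnD mulnDl expnD mulnACA.
Qed.

Notation ranges rs s := [seq f s | f <- rs].

(** Both the monomial and the block shift split over the coordinates, so the packed sum is a product
    of one-dimensional sums. In each, [q] merges the exponential factor of the monomial with the
    shift. *)
Lemma arith_packed_power_prod w rs de : (forall s, 0 < w s) -> arith k w ->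
  (forall i, arith k (nth (fun=> 0) rs i)) ->
  arith k (fun s => packed (w s) (ranges rs s) (power_prod de)).
Proof.
move=> w0 aw; elim: rs de => [|f rs IHrs] de ars.
  apply: (@arith_ext _ (fun=> 1)) (arith_const k 1) => s.
  by rewrite /= /power_prod big_ord0.
have af := ars 0; have {}ars i := ars i.+1.
pose q s := 2 ^ ((de 0).2 + w s * radix (ranges rs s)).
have radix0 s : 0 < radix (ranges rs s) by rewrite /radix prodn_gt0.
have aradix : arith k (fun s => radix (ranges rs s)).
  apply: (@arith_ext _ (fun s => \prod_(0 <= i < size rs) (nth (fun=> 0) rs i s + 1))).
    move=> s; rewrite /radix big_map [RHS](big_nth (fun=> 0)).
    by apply: eq_bigr => i _; rewrite addn1.
  by apply: arith_prod => i; apply: arith_add; [exact: ars|exact: arith_const].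
apply: (@arith_ext _ (fun s => (\sum_(j < f s) j ^ (de 0).1 * q s ^ j) *
    packed (w s) (ranges rs s) (power_prod (fun i => de i.+1)))).
  move=> s /=; rewrite big_distrl /=; apply: eq_bigr => j _.
  rewrite [packed _ _ (fun v => _ (_ :: v))](@eq_packed _ _ _ (fun v =>
     j ^ (de 0).1 * 2 ^ ((de 0).2 * j) * power_prod (fun i => de i.+1) v)).
    rewrite packedZ mulnA; congr (_ * _); rewrite /q -expnM mulnDl expnD.
    by rewrite [RHS]mulnCA [X in _ * X]mulnC.
  by move=> v _; rewrite /power_prod big_ord_recl.
apply: arith_mul; last exact: IHrs.
apply: arith_geometric => //.
  by move=> s; rewrite /q -{1}(expn0 2) ltn_exp2l // addn_gt0 muln_gt0 w0 radix0 orbT.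
by apply: arith_exp2; apply: arith_add; [exact: arith_const|exact: arith_mul].
Qed.

Lemma arith_packed w rs m P : (forall s, 0 < w s) -> arith k w ->
  (forall i, arith k (nth (fun=> 0) rs i)) -> m <= size rs -> exp_poly m P ->
  arith k (fun s => packed (w s) (ranges rs s) (P s)).
Proof.
move=> w0 aw ars mrs [l lP].
apply: (@arith_ext _ (fun s => \sum_(x <- l) aeval (env s) x.1 *
    packed (w s) (ranges rs s) (power_prod x.2))).
  move=> s; rewrite [RHS](@eq_packed _ _ _ (fun v => \sum_(x <- l) meval s v x)).
    by rewrite packed_sum; apply: eq_bigr => x _; rewrite packedZ.
  by move=> v vr; rewrite lP // vr size_map.
apply: arith_sum => x; apply: arith_mul; first by exists x.1.
exact: arith_packed_power_prod.
Qed.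

(** Monomials are monotone in the unknowns, so the corner of the box gives a bound. *)
Lemma exp_poly_bound rs m P :
  (forall i, arith k (nth (fun=> 0) rs i)) -> m <= size rs -> exp_poly m P ->
  exists2 b, arith k b & forall s v, in_box (ranges rs s) v -> P s v <= b s.
Proof.
move=> ars mrs [l lP].
exists (fun s => \sum_(x <- l) aeval (env s) x.1 * \prod_(0 <= i < size rs)
   (nth (fun=> 0) rs i s ^ (x.2 i).1 * 2 ^ ((x.2 i).2 * nth (fun=> 0) rs i s))).
  apply: arith_sum => x; apply: arith_mul; first by exists x.1.
  apply: arith_prod => i; have ac n := arith_const k n; apply: arith_mul.
    exact: arith_exp.
  by apply: arith_exp2; apply: arith_mul.
move=> s v; rewrite /in_box all2E size_map => /andP[/eqP vr vrs].
rewrite lP ?vr //; apply: leq_sum => x _; rewrite leq_mul2l.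
rewrite /power_prod vr big_mkord.
apply/orP; right; apply: leq_prod => i _.
have vi : nth 0 v i <= nth (fun=> 0) rs i s.
  have iv : i < size (zip v (ranges rs s)) by rewrite size_zip vr size_map minnn.
  have /= := all_nthP (0, 0) vrs i iv; rewrite nth_zip ?size_map //=.
  by rewrite (nth_map (fun=> 0)) // => /ltnW.
by rewrite leq_mul ?leq_expl // leq_exp2l // leq_mul2l vi orbT.
Qed.

End Monomials.

(** * Arithmetic terms as equations with unique solutions *)

Section Systems.
Variable k : nat.
Implicit Types (s v p u r : seq nat) (F G : seq nat -> seq nat -> nat).
Implicit Types (C : seq nat -> seq nat -> bool) (W : seq nat -> nat -> seq nat).

(** The inequality makes [P - Q] an exact difference, and lets a conjunction be expressed by adding
    the two sides. *)
Definition exp_poly_eqn m C := exists P Q, [/\ exp_poly k m P, exp_poly k m Q &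
  forall s v, m <= size v -> Q s v <= P s v /\ (P s v == Q s v) = C s v].

Lemma exp_poly_eqn_widen m m' C : m <= m' -> exp_poly_eqn m C -> exp_poly_eqn m' C.
Proof.
move=> mm' [P [Q [eP eQ PQ]]]; exists P, Q.
split=> [||s v /(leq_trans mm')]; last exact: PQ.
  exact: exp_poly_widen eP.
exact: exp_poly_widen eQ.
Qed.

(** [F ^ 2 + G ^ 2] is at least [2 * F * G], with equality only for [F = G]. *)
Lemma exp_poly_eqn_eq m F G : exp_poly k m F -> exp_poly k m G ->
  exp_poly_eqn m (fun s v => F s v == G s v).
Proof.
move=> eF eG; exists (fun s v => F s v * F s v + G s v * G s v).
exists (fun s v => 2 * (F s v * G s v)); split.
- by apply: exp_polyD; apply: exp_polyM.
- by apply: exp_polyM; [apply/exp_poly_param/arith_const|apply: exp_polyM].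
by move=> s v _; have [le_FG <-] := nat_Cauchy (F s v) (G s v); rewrite eq_sym.
Qed.

Lemma exp_poly_eqn_and m C C' : exp_poly_eqn m C -> exp_poly_eqn m C' ->
  exp_poly_eqn m (fun s v => C s v && C' s v).
Proof.
move=> [P [Q [eP eQ PQ]]] [P' [Q' [eP' eQ' PQ']]].
exists (fun s v => P s v + P' s v), (fun s v => Q s v + Q' s v).
split=> [||s v mv]; try exact: exp_polyD.
have [le <-] := PQ s v mv; have [le' <-] := PQ' s v mv; lia.
Qed.

Lemma exp_poly_eqn_true m : exp_poly_eqn m (fun _ _ => true).
Proof.
have e0 : exp_poly k m (fun _ _ => 0) by apply/exp_poly_param/arith_const.
by exists (fun _ _ => 0), (fun _ _ => 0); split.
Qed.

Definition bounded W := forall N, arith k N ->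
  exists2 U, arith k U & forall s y, y < N s -> all (gtn (U s)) (W s y).

(* In an environment whose first [m] entries are known, the first of them being
   the argument [y], the condition [C] on the next [n] entries holds for [W s y]
   only. *)
Definition determines m n W C :=
  [/\ exp_poly_eqn (m + n) C, bounded W, forall s y, size (W s y) = n &
   forall s p u r, size p = m -> size u = n ->
     C s (p ++ u ++ r) = (u == W s (head 0 p))].

Definition computes m n W F (f : seq nat -> nat -> nat) :=
  exp_poly k (m + n) F /\ forall s p r, size p = m ->
    F s (p ++ W s (head 0 p) ++ r) = f s (head 0 p).

Definition bounded_val (f : seq nat -> nat -> nat) := forall N, arith k N ->
  exists2 U, arith k U & forall s y, y < N s -> f s y < U s.

Lemma bounded_aeval (t : aterm k.+1) : bounded_val (fun s y => aeval (env (y :: s)) t).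
Proof.
move=> N aN; have ac n := arith_const k n.
elim: t => [||i|a [U aU Uf] b [V aV Vf]|a [U aU Uf] b _|a [U aU Uf] b [V aV Vf]
  |a [U aU Uf] b _|a [U aU Uf]] /=.
- by exists (fun=> 1).
- by exists (fun=> 2).
(* Variable 0 is the argument [y], bounded by [N]; the others are parameters. *)
- case: i => -[|i] ik.
    by exists N => // s y.
  exists (fun s => nth 0 s i + 1) => [|s y _].
    by apply: arith_add => //; apply: arith_var.
  by rewrite /env addn1.
- exists (fun s => U s + V s) => [|s y yN]; first exact: arith_add.
  by have := Uf s y yN; have := Vf s y yN; lia.
- exists U => // s y yN; exact: leq_ltn_trans (leq_subr _ _) (Uf s y yN).
- exists (fun s => U s * V s) => [|s y yN]; first exact: arith_mul.
  by rewrite ltn_mul ?Uf ?Vf.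
- exists U => // s y yN; exact: leq_ltn_trans (leq_div _ _) (Uf s y yN).
- exists (fun s => 2 ^ U s) => [|s y yN]; first exact: arith_exp2.
  by rewrite ltn_exp2l ?Uf.
Qed.

Lemma bounded_nil : bounded (fun _ _ => [::]).
Proof. by move=> N aN; exists N. Qed.

Lemma bounded_cat W W' : bounded W -> bounded W' ->
  bounded (fun s y => W s y ++ W' s y).
Proof.
move=> bW bW' N aN; have [U aU UW] := bW N aN; have [V aV VW] := bW' N aN.
exists (fun s => U s + V s) => [|s y yN]; first exact: arith_add.
rewrite all_cat; apply/andP; split.
  by apply: sub_all (UW s y yN) => x /= xU; exact: ltn_addr.
by apply: sub_all (VW s y yN) => x /= xV; exact: ltn_addl.
Qed.

Lemma bounded_cons f W : bounded_val f -> bounded W ->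
  bounded (fun s y => f s y :: W s y).
Proof.
move=> bf bW; apply: (@bounded_cat (fun s y => [:: f s y])) bW => N aN.
by have [U aU Uf] := bf N aN; exists U => // s y yN; rewrite /= Uf.
Qed.

Lemma bounded_val_le f g : (forall s y, g s y <= f s y) ->
  bounded_val f -> bounded_val g.
Proof.
move=> gf bf N aN; have [U aU Uf] := bf N aN.
by exists U => // s y yN; exact: leq_ltn_trans (gf s y) (Uf s y yN).
Qed.

(** The joint system is triangular: [C'] has to fix the new unknowns only when the earlier ones are
    right, since otherwise [C] fails. *)
Lemma determines_cat m n W C n' W' C' : determines m n W C ->
  exp_poly_eqn (m + (n + n')) C' -> bounded W' -> (forall s y, size (W' s y) = n') ->
  (forall s p u r, size p = m -> size u = n' ->
     C' s (p ++ W s (head 0 p) ++ u ++ r) = (u == W' s (head 0 p))) ->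
  determines m (n + n') (fun s y => W s y ++ W' s y) (fun s v => C s v && C' s v).
Proof.
move=> [eC bW sW CW] eC' bW' sW' CW'; split.
- by apply: exp_poly_eqn_and => //; apply: exp_poly_eqn_widen eC; lia.
- exact: bounded_cat.
- by move=> s y; rewrite size_cat sW sW'.
move=> s p u r pm un; rewrite -(cat_take_drop n u) -catA CW //; last first.
  by rewrite size_takel // un leq_addr.
have su : size (take n u) = size (W s (head 0 p)).
  by rewrite sW size_takel // un leq_addr.
rewrite eqseq_cat //; case: eqP => //= ->; rewrite CW' //.
by rewrite size_drop un addKn.
Qed.

Lemma computes_cat m n W F f n' W' : computes m n W F f ->
  computes m (n + n') (fun s y => W s y ++ W' s y) F f.
Proof.
move=> [eF Ff]; split=> [|s p r pm]; first by apply: exp_poly_widen eF; lia.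
by rewrite -catA Ff.
Qed.

(** The unknowns of the first system count as known entries for the second; as [0 < m], the head of
    the known part is still the argument. *)
Lemma determines_after m n W C n' W' C' : 0 < m -> determines m n W C ->
  determines (m + n) n' W' C' ->
  determines m (n + n') (fun s y => W s y ++ W' s y) (fun s v => C s v && C' s v).
Proof.
move=> m0 dW [eC' bW' sW' CW']; apply: determines_cat => //; first by rewrite addnA.
have [_ _ sW _] := dW.
move=> s p u r pm un; rewrite catA CW' ?size_cat ?pm ?sW //.
by case: p pm => // pm; rewrite -pm in m0.
Qed.

Lemma computes_after m n W n' W' F f : 0 < m -> (forall s y, size (W s y) = n) ->
  computes (m + n) n' W' F f ->
  computes m (n + n') (fun s y => W s y ++ W' s y) F f.
Proof.
move=> m0 sW [eF Ff]; split=> [|s p r pm]; first by rewrite addnA.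
have hp : head 0 (p ++ W s (head 0 p)) = head 0 p.
  by case: p pm => // pm; rewrite -pm in m0.
by rewrite -catA catA -{2}hp Ff ?hp // size_cat pm sW.
Qed.

Definition computable m f := exists n W C F,
  determines m n W C /\ computes m n W F f.

Lemma computable_pair m f g : 0 < m ->
  (forall m', 0 < m' -> computable m' f) -> (forall m', 0 < m' -> computable m' g) ->
  exists n W C F G, [/\ determines m n W C, computes m n W F f & computes m n W G g].
Proof.
move=> m0 /(_ m m0)[n [W [C [F [dW cF]]]]] /(_ (m + n)) cg.
have [|n' [W' [C' [G [dW' cG]]]]] := cg; first by rewrite addn_gt0 m0.
have [_ _ sW _] := dW.
exists (n + n'), (fun s y => W s y ++ W' s y), (fun s v => C s v && C' s v), F, G.
by split; [exact: determines_after|exact: computes_cat|exact: computes_after].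
Qed.

Lemma computable_poly m F f : exp_poly k m F ->
  (forall s p r, size p = m -> F s (p ++ r) = f s (head 0 p)) -> computable m f.
Proof.
move=> eF Ff; exists 0, (fun _ _ => [::]), (fun _ _ => true), F; split; split.
- exact: exp_poly_eqn_true.
- exact: bounded_nil.
- by [].
- by move=> s p u r _ /size0nil->.
- by rewrite addn0.
by [].
Qed.

(** * Systems for the single operations *)

Lemma nth_known m n s p u r W i : size p = m -> size (W s (head 0 p)) = n ->
  i < size u -> nth 0 (p ++ W s (head 0 p) ++ u ++ r) (m + n + i) = nth 0 u i.
Proof.
move=> pm Wn iu; rewrite catA nth_cat size_cat pm Wn ltnNge leq_addr addKn /=.
by rewrite nth_cat iu.
Qed.

(** Only an unknown may stand in the exponent of a monomial, so a fresh unknown is equated with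
    [F]. *)
Lemma computable_exp2 m f : 0 < m -> bounded_val f ->
  computable m f -> computable m (fun s y => 2 ^ f s y).
Proof.
move=> m0 bf [n [W [C [F [dW [eF Ff]]]]]]; have [_ _ sW _] := dW.
pose C' s v := nth 0 v (m + n) == F s v.
have sz u : size u = 1 -> exists x, u = [:: x] by case: u => [|x []] // _; exists x.
exists (n + 1), (fun s y => W s y ++ [:: f s y]), (fun s v => C s v && C' s v).
exists (fun _ v => 2 ^ nth 0 v (m + n)); split.
  apply: determines_cat => //; last first.
  - move=> s p u r pm /sz[x ->]; rewrite /C' -{1}[m + n]addn0 nth_known //= Ff //.
    by rewrite eqseq_cons andbT.
  - by apply: bounded_cons => //; exact: bounded_nil.
  apply: exp_poly_eqn_eq; first by apply: exp_poly_var; lia.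
  by apply: exp_poly_widen eF; lia.
split=> [|s p r pm]; first by apply: exp_poly_exp2; lia.
by rewrite -catA -[m + n]addn0 nth_known.
Qed.

(** The truncated differences are the positive and negative parts of the integer [a - b]. *)
Lemma sub_unique a b d e :
  (a + e == b + d) && (d * e == 0) = ([:: d; e] == [:: a - b; b - a]).
Proof. by rewrite !eqseq_cons andbT muln_eq0; lia. Qed.

Lemma computable_sub m f g : 0 < m -> bounded_val f -> bounded_val g ->
  (forall m', 0 < m' -> computable m' f) -> (forall m', 0 < m' -> computable m' g) ->
  computable m (fun s y => f s y - g s y).
Proof.
move=> m0 bf bg cf cg.
have [n [W [C [F [G [dW [eF Ff] [eG Gg]]]]]]] := computable_pair m0 cf cg.
have [_ _ sW _] := dW.
pose C' s v := (F s v + nth 0 v (m + n + 1) == G s v + nth 0 v (m + n + 0)) &&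
  (nth 0 v (m + n + 0) * nth 0 v (m + n + 1) == 0).
have evar i : i < 2 -> exp_poly k (m + (n + 2)) (fun _ v => nth 0 v (m + n + i)).
  by move=> i2; apply: exp_poly_var; lia.
have {}eF : exp_poly k (m + (n + 2)) F by apply: exp_poly_widen eF; lia.
have {}eG : exp_poly k (m + (n + 2)) G by apply: exp_poly_widen eG; lia.
have ec c : exp_poly k (m + (n + 2)) (fun _ _ => c) by apply/exp_poly_param/arith_const.
have sz u : size u = 2 -> exists x y, u = [:: x; y].
  by case: u => [|x [|y []]] // _; exists x, y.
exists (n + 2), (fun s y => W s y ++ [:: f s y - g s y; g s y - f s y]).
exists (fun s v => C s v && C' s v), (fun _ v => nth 0 v (m + n + 0)); split.
  apply: determines_cat => //; last first.
  - move=> s p u r pm /sz[d [e ->]]; rewrite /C' !nth_known // Ff // Gg //.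
    exact: sub_unique.
  - do !apply: bounded_cons; last exact: bounded_nil.
      by apply: bounded_val_le bf => s y; exact: leq_subr.
    by apply: bounded_val_le bg => s y; exact: leq_subr.
  apply: exp_poly_eqn_and; apply: exp_poly_eqn_eq => //.
  - by apply: exp_polyD => //; apply: evar.
  - by apply: exp_polyD => //; apply: evar.
  - by apply: exp_polyM; apply: evar.
split=> [|s p r pm]; first exact: evar.
by rewrite -catA nth_known.
Qed.

(* [z] is 1 when [b = 0] and 0 otherwise, and [z'] is [b - 1]: the division is
   really by [b + z], and [z * a] makes the quotient vanish when [b = 0]. *)
Lemma div_unique a b q z z' x x' :
  [&& 1 + z' == b + z, z * z' == 0, a == q * (b + z) + x + z * a &
      x + x' + 1 == b + z] =
  ([:: q; z; z'; x; x'] ==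
   [:: a %/ b; 1 - b; b - 1; a %% b * (1 - (1 - b)); b - 1 - a %% b * (1 - (1 - b))]).
Proof.
rewrite !eqseq_cons andbT; case: b => [|b].
  rewrite divn0 subn0 subnn muln0.
  apply/and4P/and5P=> [[/eqP zE /eqP zz0 /eqP aE /eqP xE]|].
    have z1 : z = 1 by case: z zE zz0 {aE xE} => [|[|z]]; nia.
    by split; apply/eqP; subst z; lia.
  by case=> /eqP-> /eqP-> /eqP-> /eqP-> /eqP->; split; rewrite ?mul1n ?muln0.
rewrite subSS sub0n subn0 muln1 subn1 /=.
apply/and4P/and5P=> [[/eqP zE /eqP zz0 /eqP aE /eqP xE]|].
  have z0 : z = 0 by nia.
  subst z; rewrite addn0 mul0n addn0 in aE xE zE.
  have xb : x < b.+1 by lia.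
  have -> : a %/ b.+1 = q by rewrite aE divnMDl // divn_small // addn0.
  have -> : a %% b.+1 = x by rewrite aE modnMDl modn_small.
  by split; apply/eqP; lia.
have := ltn_pmod a (ltn0Sn b); have := divn_eq a b.+1.
move=> aE xb [/eqP-> /eqP-> /eqP-> /eqP-> /eqP->].
by split; rewrite ?mul0n ?addn0 //; [rewrite -aE|lia].
Qed.

Lemma computable_div m f g : 0 < m -> bounded_val f -> bounded_val g ->
  (forall m', 0 < m' -> computable m' f) -> (forall m', 0 < m' -> computable m' g) ->
  computable m (fun s y => f s y %/ g s y).
Proof.
move=> m0 bf bg cf cg.
have [n [W [C [F [G [dW [eF Ff] [eG Gg]]]]]]] := computable_pair m0 cf cg.
have [_ _ sW _] := dW.
pose q v := nth 0 v (m + n + 0); pose z v := nth 0 v (m + n + 1).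
pose z' v := nth 0 v (m + n + 2); pose x v := nth 0 v (m + n + 3).
pose x' v := nth 0 v (m + n + 4).
pose C' s v := [&& 1 + z' v == G s v + z v, z v * z' v == 0,
  F s v == q v * (G s v + z v) + x v + z v * F s v & x v + x' v + 1 == G s v + z v].
(* As [a %% 0 = a], the factor [1 - (1 - b)] is there to make the remainder 0 when [b = 0]. The last
   entry is the slack showing that the remainder is below the divisor. *)
pose W' s y := let a := f s y in let b := g s y in
  [:: a %/ b; 1 - b; b - 1; (a %% b) * (1 - (1 - b)); b - 1 - a %% b * (1 - (1 - b))].
have evar i : i < 5 -> exp_poly k (m + (n + 5)) (fun _ v => nth 0 v (m + n + i)).
  by move=> i5; apply: exp_poly_var; lia.
have eq := evar 0 isT; have ez := evar 1 isT; have ez' := evar 2 isT.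
have ex := evar 3 isT; have ex' := evar 4 isT.
have {}eF : exp_poly k (m + (n + 5)) F by apply: exp_poly_widen eF; lia.
have {}eG : exp_poly k (m + (n + 5)) G by apply: exp_poly_widen eG; lia.
have ec c : exp_poly k (m + (n + 5)) (fun _ _ => c) by apply/exp_poly_param/arith_const.
have sz u : size u = 5 -> exists a b c d e, u = [:: a; b; c; d; e].
  by case: u => [|a [|b [|c [|d [|e []]]]]] // _; exists a, b, c, d, e.
have eGz : exp_poly k (m + (n + 5)) (fun s v => G s v + z v) by exact: exp_polyD.
exists (n + 5), (fun s y => W s y ++ W' s y).
exists (fun s v => C s v && C' s v), (fun _ v => q v); split.
  apply: determines_cat => //; last first.
  - move=> s p u r pm /sz[a [b [c [d [e ->]]]]].
    by rewrite /C' /q /z /z' /x /x' !nth_known // Ff // Gg //; exact: div_unique.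
  - have b1 : bounded_val (fun _ _ => 1).
      by move=> N aN; exists (fun=> 2) => //; exact: arith_const.
    do !apply: bounded_cons; last exact: bounded_nil.
    + by apply: bounded_val_le bf => s y; exact: leq_div.
    + by apply: bounded_val_le b1 => s y; exact: leq_subr.
    + by apply: bounded_val_le bg => s y; exact: leq_subr.
    + apply: bounded_val_le bf => s y; apply: leq_trans (leq_mod _ (g s y)).
      by rewrite -[leqRHS]muln1 leq_mul2l leq_subr orbT.
    + by apply: bounded_val_le bg => s y; rewrite -subnDA leq_subr.
  apply: exp_poly_eqn_and; first by apply: exp_poly_eqn_eq => //; exact: exp_polyD.
  apply: exp_poly_eqn_and; first by apply: exp_poly_eqn_eq => //; exact: exp_polyM.
  apply: exp_poly_eqn_and; apply: exp_poly_eqn_eq => //.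
    by apply: exp_polyD; [apply: exp_polyD => //|]; apply: exp_polyM.
  by apply: exp_polyD => //; exact: exp_polyD.
split=> [|s p r pm]; first exact: eq.
by rewrite /q -catA nth_known.
Qed.

(** Sums and products of exponential polynomials need no new unknowns; the other three operations
    add some. The induction covers all [m], since subterms are computed one after the other. *)
Lemma computable_aeval (t : aterm k.+1) m : 0 < m ->
  computable m (fun s y => aeval (env (y :: s)) t).
Proof.
have ec m' c : exp_poly k m' (fun _ _ => c) by apply/exp_poly_param/arith_const.
elim: t m => [||i|a IHa b IHb|a IHa b IHb|a IHa b IHb|a IHa b IHb|a IHa] m m0 /=.
- exact: (computable_poly (ec m 0)).
- exact: (computable_poly (ec m 1)).
- case: i => -[|i] ik.
    apply: computable_poly (exp_poly_var k m0) _ => s p r pm.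
    by case: p pm => // pm; rewrite -pm in m0.
  by apply: (computable_poly (exp_poly_param m (arith_var (ik : i < k)))).
- have [n [W [C [F [G [dW [eF Ff] [eG Gg]]]]]]] := computable_pair m0 IHa IHb.
  exists n, W, C, (fun s v => F s v + G s v); split=> //; split.
    exact: exp_polyD.
  by move=> s p r pm; rewrite Ff ?Gg.
- by apply: computable_sub => //; apply: bounded_aeval.
- have [n [W [C [F [G [dW [eF Ff] [eG Gg]]]]]]] := computable_pair m0 IHa IHb.
  exists n, W, C, (fun s v => F s v * G s v); split=> //; split.
    exact: exp_polyM.
  by move=> s p r pm; rewrite Ff ?Gg.
- by apply: computable_div => //; apply: bounded_aeval.
- by apply: computable_exp2 (IHa m m0); rewrite //; exact: bounded_aeval.
Qed.

(** * Counting solutions in a box *)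

Lemma arith_count_eqn rs m C : (forall i, arith k (nth (fun=> 0) rs i)) ->
  m <= size rs -> exp_poly_eqn m C ->
  arith k (fun s => box_sum [seq f s | f <- rs] (fun v => C s v)).
Proof.
move=> ars mrs [P [Q [eP eQ PQ]]].
have ac n := arith_const k n.
have [b ab bP] := exp_poly_bound ars mrs eP.
(* The values of [P - Q] are at most [b s], hence fit in [u s] bits; adding 1 keeps the width
   positive. *)
pose u s := b s + 1; have au : arith k u by exact: arith_add.
pose X s := packed (u s + u s) [seq f s | f <- rs] (P s)
  - packed (u s + u s) [seq f s | f <- rs] (Q s).
apply: (@arith_ext _ (fun s => \prod_(0 <= i < size rs) nth (fun=> 0) rs i s -
   popcount ((2 ^ u s - 1) * X s) %/ u s)); last first.
  apply: arith_sub; first exact: arith_prod.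
  apply: arith_div => //; apply: arith_popcount; apply: arith_mul.
    by apply: arith_sub => //; exact: arith_exp2.
  have a2u : arith k (fun s => u s + u s) by exact: arith_add.
  have u2 s : 0 < u s + u s by rewrite /u; lia.
  by apply: arith_sub; apply: arith_packed eP || apply: arith_packed eQ.
move=> s.
have in_size v : in_box [seq f s | f <- rs] v -> m <= size v.
  by rewrite /in_box all2E size_map => /andP[/eqP->].
rewrite (@eq_box_sum _ (fun v => C s v) (fun v => P s v - Q s v == 0)); last first.
  by move=> v /in_size mv; have [le_QP <-] := PQ s v mv; lia.
rewrite (@box_sum_eq0 (u s)); first last.
- move=> v rv; apply: leq_ltn_trans (leq_subr _ _) _.
  apply: leq_ltn_trans (bP s v rv) _; apply: ltn_trans (ltn_expl (u s) _) => //.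
  by rewrite /u addn1.
- by rewrite /u addn1.
rewrite big_map (big_nth (fun=> 0)) subn1; congr (_ - popcount (_ * _) %/ _).
rewrite /X -[X in X - _](@eq_packed _ _ (fun v => P s v - Q s v + Q s v)).
  by rewrite packedD addnK.
by move=> v; rewrite size_map => vr; rewrite subnK //; case: (PQ s v) => //; rewrite vr.
Qed.

End Systems.

(** The unknowns are determined by [i] and lie in the box, so each zero [i] yields exactly one
    solution of the system extended by [F = 0]. *)
Lemma arith_count k N f : arith k N -> arith k.+1 f ->
  arith k (fun s => \sum_(i < N s) (f (nat_of_ord i :: s) == 0)).
Proof.
move=> aN [t tf].
have [n [W [C [F [[eC bW sW CW] [eF Ff]]]]]] := computable_aeval t (isT : 0 < 1).
have [U aU UW] := bW N aN.
have e0 : exp_poly k (1 + n) (fun _ _ => 0) by apply/exp_poly_param/arith_const.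
have eqn := exp_poly_eqn_and eC (exp_poly_eqn_eq eF e0).
apply: arith_ext (@arith_count_eqn _ (N :: nseq n U) _ _ _ _ eqn); last 2 first.
- case=> // i /=; rewrite nth_nseq.
  by case: ifP => _ //; exact: arith_const.
- by rewrite /= size_nseq.
move=> s /=; rewrite map_nseq; apply: eq_bigr => i _.
have rW : in_box (nseq n (U s)) (W s i).
  have := UW s i (ltn_ord i); rewrite /in_box -(sW s i).
  by elim: (W s i) => //= x w IHw /andP[-> /IHw].
(* For fixed [i], only the vector [W s i] can contribute to the sum over the unknowns. *)
rewrite -[RHS]mul1n -(box_sum_pred1 rW) mulnC -box_sumZ; apply: eq_box_sum => u.
rewrite /in_box all2E size_nseq => /andP[/eqP un _].
have Ci := CW s [:: nat_of_ord i] u [::] erefl un; rewrite /= cats0 in Ci; rewrite Ci.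
case: eqP => [->|]; last by rewrite muln0.
have := Ff s [:: nat_of_ord i] [::] erefl; rewrite /= cats0 => ->.
by rewrite tf muln1.
Qed.

(** * Counting up to the greatest prime *)

Lemma sum_ltn_indicator n p : p <= n -> \sum_(j < n) (j < p : nat) = p.
Proof.
move=> pn; rewrite -(subnKC pn) big_split_ord /=.
rewrite (eq_bigr (fun=> 1)) => [|j _]; last by rewrite ltn_ord.
rewrite sum_nat_const card_ord muln1 big1 ?addn0 // => j _.
by rewrite ltnNge leq_addr.
Qed.

(** Since [m %% 0 = m], the index [d = 0] adds nothing for positive [m]. *)
Definition divisor_count m := \sum_(d < m.+1) (m %% d == 0).

Lemma divisor_count_eq2 m : 0 < m -> (divisor_count m == 2) = prime m.
Proof.
case: m => [|[|m]] // _; first by rewrite /divisor_count !big_ord_recl big_ord0.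
rewrite /divisor_count big_ord_recr big_ord_recl /= modnn eqxx add0n addn1.
rewrite big_ord_recl /= modn1 add1n !eqSS.
(* The indices 0, 1 and [m.+2] are split off; [i < m] stands for the candidate divisor [i + 2]. *)
rewrite sum_nat_eq0; apply/forallP/primeP => [no_div|[_ div_m] i].
  split=> // d dm; have d0 : 0 < d by exact: dvdn_gt0 dm.
  have dm' : d <= m.+2 by exact: dvdn_leq.
  case: eqVneq => //= d1; case: eqVneq => //= dm2.
  have dm3 : d - 2 < m by lia.
  have := no_div (Ordinal dm3); rewrite /= /bump /= eqb0.
  have -> : 1 + (1 + (d - 2)) = d by lia.
  by rewrite -/(d %| m.+2) dm.
rewrite /bump /= !add1n eqb0; apply/negP => /(div_m i.+2).
by have := ltn_ord i; lia.
Qed.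

Definition primes_between j n := \sum_(i < n - j) prime (j + i).+1.

Lemma primes_between_gt0P j n :
  reflect (exists2 q, prime q & j < q <= n) (0 < primes_between j n).
Proof.
rewrite lt0n sum_nat_eq0 negb_forall; apply: (iffP existsP) => [[i]|[q q_pr jqn]].
  rewrite eqb0 negbK => i_pr; exists (j + i).+1 => //.
  by have := ltn_ord i; lia.
have ij : q - j.+1 < n - j by lia.
exists (Ordinal ij); rewrite eqb0 negbK /=.
by have -> : (j + (q - j.+1)).+1 = q by lia.
Qed.

Definition last_prime n := \sum_(j < n) (0 < primes_between j n : nat).

Lemma last_primeP n : 2 <= n -> greatest_prime_le n (last_prime n).
Proof.
move=> n2; pose P q := prime q && (q <= n).
have exP : exists q, P q by exists 2; rewrite /P n2.
have ubP q : P q -> q <= n by case/andP.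
case: (ex_maxnP exP ubP) => p /andP[p_pr pn] max_p.
suff -> : last_prime n = p by split=> // q q_pr qn; apply: max_p; rewrite /P q_pr.
rewrite -[RHS](sum_ltn_indicator pn); apply: eq_bigr => j _; congr (nat_of_bool _).
apply/primes_between_gt0P/idP => [[q q_pr /andP[jq qn]]|jp].
  by apply: leq_trans jq _; apply: max_p; rewrite /P q_pr.
by exists p; rewrite // jp.
Qed.

(** Three nested counts, each binding a new variable 0; innermost, the list is [[:: d; i; j; n]]. *)
Lemma arith_last_prime : arith 1 (fun s => last_prime (nth 0 s 0)).
Proof.
have ac k n := arith_const k n.
have divs : arith 3 (fun s => divisor_count (nth 0 s 1 + nth 0 s 0).+1).
  pose m s := nth 0 s 1 + nth 0 s 0 + 1.
  apply: (@arith_ext _ (fun s => \sum_(d < m s + 1) (m s %% d == 0))).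
    by move=> s; rewrite /m !addn1.
  apply: (@arith_count 3 (fun s => m s + 1)
    (fun s => (nth 0 s 2 + nth 0 s 1 + 1) %% nth 0 s 0)).
    by do !apply: arith_add => //; apply: arith_var.
  by apply: arith_mod; do ?apply: arith_add => //; apply: arith_var.
have betw : arith 2 (fun s => primes_between (nth 0 s 0) (nth 0 s 1)).
  pose D s := divisor_count (nth 0 s 1 + nth 0 s 0).+1.
  (* The test [D = 2] is recast as the vanishing of [(D - 2) + (2 - D)]. *)
  apply: (@arith_ext _ (fun s => \sum_(i < nth 0 s 1 - nth 0 s 0)
      ((D (nat_of_ord i :: s) - 2 + (2 - D (nat_of_ord i :: s))) == 0))).
    move=> s; apply: eq_bigr => i _; rewrite -divisor_count_eq2 // /D /=; lia.
  apply: (@arith_count 2 (fun s => nth 0 s 1 - nth 0 s 0)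
    (fun s => D s - 2 + (2 - D s))).
    by apply: arith_sub; apply: arith_var.
  by apply: arith_add; apply: arith_sub.
apply: (@arith_ext _ (fun s => \sum_(j < nth 0 s 0)
  (1 - primes_between (nat_of_ord j) (nth 0 s 0) == 0))).
  by move=> s; apply: eq_bigr => j _; rewrite subn_eq0.
apply: (@arith_count 1 (fun s => nth 0 s 0)
  (fun s => 1 - primes_between (nth 0 s 0) (nth 0 s 1))).
  exact: arith_var.
exact: arith_sub.
Qed.

Lemma aeval_ext k (x y : 'I_k -> nat) (t : aterm k) : x =1 y -> aeval x t = aeval y t.
Proof.
by move=> xy; elim: t => //= [a -> b ->|a -> b ->|a -> b ->|a -> b ->|a ->].
Qed.

Theorem corollary3p2 :
  exists T4 : aterm 1, forall n : nat, 2 <= n -> greatest_prime_le n (aeval1 T4 n).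
Proof.
have [t tE] := arith_last_prime; exists t => n n2.
rewrite /aeval1 (@aeval_ext _ _ (env [:: n])) => [|i]; last by rewrite ord1.
by rewrite tE; apply: last_primeP.
Qed.
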